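(* Let $\mathfrak{hs}_3\mathfrak{car1}$ (respectively $\mathfrak{hs}_3\mathfrak{car2}$) be the Lie algebra obtained from $\mathfrak{hs}_3\mathfrak{(A)dS}$ by successively applying the contraction procedures 1 and 5 (respectively 1 and 6) defined in the context. Then each of $\mathfrak{hs}_3\mathfrak{car1}$ and $\mathfrak{hs}_3\mathfrak{car2}$ admits an invariant metric (a nondegenerate ad-invariant symmetric bilinear form), given by the form whose only non-zero components are $$\langle H,J\rangle=-1,\qquad \langle P_a,G_b\rangle=\delta_{ab},\qquad \langle H_a,J_b\rangle=-\delta_{ab},\qquad \langle P_{ab},G_{cd}\rangle=\delta_{ac}\delta_{db}+\delta_{ad}\delta_{cb}-\tfrac23\delta_{ab}\delta_{cd}.$$
   Context: Conventions. Indices $A,B,\dots\in\{0,1,2\}$, $a,b,\dots\in\{1,2\}$; $\eta=\mathrm{diag}(-1,1,1)$ raises and lowers indices; $\epsilon_{ABC}$ is totally antisymmetric with $\epsilon_{012}=1$. Symmetrization has no normalization factor, $T_{(ab)}=T_{ab}+T_{ba}$, and nested symmetrizations are taken from the outermost to the innermost, e.g. $T_{(A(CD)B)}=T_{ACDB}+T_{ADCB}+T_{BCDA}+T_{BDCA}$. $\mathfrak{hs}_3\mathfrak{(A)dS}$: the 16-dimensional real Lie algebra spanned by $\hat J_A,\hat P_A,\hat J_{AB},\hat P_{AB}$, with $\hat J_{AB}=\hat J_{BA}$, $\hat P_{AB}=\hat P_{BA}$, $\eta^{AB}\hat J_{AB}=\eta^{AB}\hat P_{AB}=0$, and brackets (upper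 sign AdS, lower sign dS) $[\hat J_A,\hat J_B]=\epsilon_{ABC}\hat J^C$, $[\hat J_A,\hat P_B]=\epsilon_{ABC}\hat P^C$, $[\hat P_A,\hat P_B]=\pm\epsilon_{ABC}\hat J^C$, $[\hat J_A,\hat J_{BC}]=\epsilon^M{}_{A(B}\hat J_{C)M}$, $[\hat J_A,\hat P_{BC}]=[\hat P_A,\hat J_{BC}]=\epsilon^M{}_{A(B}\hat P_{C)M}$, $[\hat P_A,\hat P_{BC}]=\pm\epsilon^M{}_{A(B}\hat J_{C)M}$, $[\hat J_{AB},\hat J_{CD}]=-\eta_{(A(C}\epsilon_{D)B)M}\hat J^M$, $[\hat J_{AB},\hat P_{CD}]=-\eta_{(A(C}\epsilon_{D)B)M}\hat P^M$, $[\hat P_{AB},\hat P_{CD}]=\mp\eta_{(A(C}\epsilon_{D)B)M}\hat J^M$. Basis. $J=\hat J_0$, $G_a=\hat J_a$, $H=\hat P_0$, $P_a=\hat P_a$, $J_a=\hat J_{0a}$, $G_{ab}=\hat J_{ab}$, $H_a=\hat P_{0a}$, $P_{ab}=\hat P_{ab}$, with $\hat J_{00}=G_{11}+G_{22}$, $\hat P_{00}=P_{11}+P_{22}$. Listing $G_a$, $G_{ab}$, etc. means all components. Contraction procedure for a decomposition $\mathfrak{g}=\mathfrak{h}+\mathfrak{i}$ with $\mathfrak{h}$ a subalgebra: the new Lie algebra on the same vector space in which brackets $[\mathfrak{h},\mathfrak{h}]$ are unchanged, brackets $[\mathfrak{h},\mathfrak{i}]$ are replaced by their $\mathfrak{i}$-component,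 and $[\mathfrak{i},\mathfrak{i}]=0$. Successive application means applying the second procedure to the Lie algebra resulting from the first. Procedure 1: $\mathfrak{h}=\{J,G_a,J_a,G_{ab}\}$, $\mathfrak{i}=\{H,P_a,H_a,P_{ab}\}$. Procedure 5: $\mathfrak{h}=\{J,P_a,J_a,P_{ab}\}$, $\mathfrak{i}=\{G_a,H,H_a,G_{ab}\}$. Procedure 6: $\mathfrak{h}=\{J,P_a,H_a,G_{ab}\}$, $\mathfrak{i}=\{G_a,H,J_a,P_{ab}\}$. The results are the same starting from AdS or dS. *)

(* Defs.v *)
From mathcomp Require Import all_boot all_order all_algebra.
From mathcomp Require Import reals.

Set Implicit Arguments.
Unset Strict Implicit.
Unset Printing Implicit Defensive.

Import GRing.Theory Num.Theory.
Local Open Scope ring_scope.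

Record is_lie_bracket (R : realType) (L : vectType R) (br : L -> L -> L) : Prop := {
  lie_linearl : forall y, linear (fun x => br x y);
  lie_linearr : forall x, linear (br x);
  lie_alternating : forall x, br x x = 0;
  lie_jacobi : forall x y z, br x (br y z) + br y (br z x) + br z (br x y) = 0
}.

Definition ad_invariant (R : realType) (L : vectType R) (br : L -> L -> L)
    (B : L -> L -> R) : Prop :=
  forall x y z, B (br x y) z = B x (br y z).

(* [{symmetric L}] is the type of symmetric bilinear forms on [L]. *)
Definition invariant_metric (R : realType) (L : vectType R) (br : L -> L -> L)
    (B : {symmetric L}) : Prop :=
  nondegenerate B /\ ad_invariant br B.

Definition is_subalgebra (R : realType) (L : vectType R) (br : L -> L -> L)
    (h : {vspace L}) : Prop :=
  forall x y, x \in h -> y \in h -> br x y \in h.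

Definition is_decomposition (R : realType) (L : vectType R) (br : L -> L -> L)
    (h i : {vspace L}) : Prop :=
  [/\ (h + i)%VS = fullv, directv (h + i) & is_subalgebra br h].

(* For L = h + i (direct), [daddv_pi h i] is the projection onto h along i. *)
Definition contraction (R : realType) (L : vectType R) (br : L -> L -> L)
    (h i : {vspace L}) : L -> L -> L :=
  fun x y =>
    let ph := daddv_pi h i in
    let pi := daddv_pi i h in
    br (ph x) (ph y) + pi (br (ph x) (pi y)) + pi (br (pi x) (ph y)).

(* Spacetime indices A in {0, 1, 2} range over 'I_3; a spatial index a in {1, 2}
   is encoded as a - 1 in 'I_2. *)
Definition sp (a : 'I_2) : 'I_3 := lift ord0 a.

Definition delta (R : realType) (n : nat) (i j : 'I_n) : R := (i == j)%:R.
Arguments delta {R n} i j.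

(* diag(-1, 1, 1); it is its own inverse, so it also raises indices. *)
Definition eta (R : realType) (A B : 'I_3) : R :=
  if A == B then (if A == ord0 then -1 else 1) else 0.
Arguments eta {R} A B.

(* (B - A) (C - A) (C - B) / 2 is totally antisymmetric and equals 1 at
   (A, B, C) = (0, 1, 2). *)
Definition eps (R : realType) (A B C : 'I_3) : R :=
  (B%:R - A%:R) * (C%:R - A%:R) * (C%:R - B%:R) / 2%:R.
Arguments eps {R} A B C.

(* epsilon^M_{A B} *)
Definition eps_up (R : realType) (M A B : 'I_3) : R :=
  \sum_(N < 3) eta M N * eps N A B.
Arguments eps_up {R} M A B.

(* X^A for a family X_A of vectors *)
Definition raise (R : realType) (L : vectType R) (X : 'I_3 -> L) (A : 'I_3) : L :=
  \sum_(B < 3) eta A B *: X B.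

(* T_{(A B)} *)
Definition sym2 (V : zmodType) (T : 'I_3 -> 'I_3 -> V) (A B : 'I_3) : V :=
  T A B + T B A.

(* T_{(A (C D) B)} *)
Definition sym_nested (V : zmodType) (T : 'I_3 -> 'I_3 -> 'I_3 -> 'I_3 -> V)
    (A C D B : 'I_3) : V :=
  T A C D B + T A D C B + T B C D A + T B D C A.

(* epsilon_{A B C} X^C *)
Definition eps_vec (R : realType) (L : vectType R) (X : 'I_3 -> L)
    (A B : 'I_3) : L :=
  \sum_(C < 3) eps A B C *: raise X C.

(* epsilon^M_{A (B} X_{C) M} *)
Definition eps_tens (R : realType) (L : vectType R) (X : 'I_3 -> 'I_3 -> L)
    (A B C : 'I_3) : L :=
  \sum_(M < 3) sym2 (fun B' C' => eps_up M A B' *: X C' M) B C.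

(* eta_{(A (C} epsilon_{D) B) M} X^M *)
Definition eta_eps_vec (R : realType) (L : vectType R) (X : 'I_3 -> L)
    (A B C D : 'I_3) : L :=
  \sum_(M < 3)
    sym_nested (fun A' C' D' B' => eta A' C' * eps D' B' M) A C D B *: raise X M.

Inductive background := AdS | dS.

Definition bg_sign (R : realType) (s : background) : R :=
  match s with AdS => 1 | dS => -1 end.
Arguments bg_sign {R} s.

Record hs3_generators (R : realType) (L : vectType R) := Hs3Generators {
  gJ1 : 'I_3 -> L;
  gP1 : 'I_3 -> L;
  gJ2 : 'I_3 -> 'I_3 -> L;
  gP2 : 'I_3 -> 'I_3 -> L
}.

Definition generator_seq (R : realType) (L : vectType R) (g : hs3_generators L) :
    seq L :=
  [seq gJ1 g A | A : 'I_3] ++ [seq gP1 g A | A : 'I_3]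
  ++ [seq gJ2 g A B | A <- enum 'I_3, B <- enum 'I_3]
  ++ [seq gP2 g A B | A <- enum 'I_3, B <- enum 'I_3].

(* (L, br) is hs_3 AdS or hs_3 dS. The span and dimension conditions leave no
   linear relations among the generators besides symmetry and tracelessness. *)
Record is_hs3 (R : realType) (L : vectType R) (s : background)
    (br : L -> L -> L) (g : hs3_generators L) : Prop := {
  hs3_lie : is_lie_bracket br;
  hs3_dim : \dim {:L} = 16;
  hs3_span : <<generator_seq g>>%VS = fullv;
  hs3_J2_sym : forall A B, gJ2 g A B = gJ2 g B A;
  hs3_P2_sym : forall A B, gP2 g A B = gP2 g B A;
  hs3_J2_tr : \sum_(A < 3) \sum_(B < 3) eta A B *: gJ2 g A B = 0;
  hs3_P2_tr : \sum_(A < 3) \sum_(B < 3) eta A B *: gP2 g A B = 0;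
  hs3_J1J1 : forall A B, br (gJ1 g A) (gJ1 g B) = eps_vec (gJ1 g) A B;
  hs3_J1P1 : forall A B, br (gJ1 g A) (gP1 g B) = eps_vec (gP1 g) A B;
  hs3_P1P1 : forall A B,
    br (gP1 g A) (gP1 g B) = bg_sign s *: eps_vec (gJ1 g) A B;
  hs3_J1J2 : forall A B C,
    br (gJ1 g A) (gJ2 g B C) = eps_tens (gJ2 g) A B C;
  hs3_J1P2 : forall A B C,
    br (gJ1 g A) (gP2 g B C) = eps_tens (gP2 g) A B C;
  hs3_P1J2 : forall A B C,
    br (gP1 g A) (gJ2 g B C) = eps_tens (gP2 g) A B C;
  hs3_P1P2 : forall A B C,
    br (gP1 g A) (gP2 g B C) = bg_sign s *: eps_tens (gJ2 g) A B C;
  hs3_J2J2 : forall A B C D,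
    br (gJ2 g A B) (gJ2 g C D) = - eta_eps_vec (gJ1 g) A B C D;
  hs3_J2P2 : forall A B C D,
    br (gJ2 g A B) (gP2 g C D) = - eta_eps_vec (gP1 g) A B C D;
  hs3_P2P2 : forall A B C D,
    br (gP2 g A B) (gP2 g C D) = - bg_sign s *: eta_eps_vec (gJ1 g) A B C D
}.

(* Names for J, G_a, H, P_a, J_a, G_ab, H_a, P_ab; the labels [LGG a b] and
   [LGG b a] name the same vector, and likewise for [LPP]. *)
Inductive label :=
  | LJ | LG of 'I_2 | LH | LP of 'I_2
  | LJv of 'I_2 | LGG of 'I_2 & 'I_2 | LHv of 'I_2 | LPP of 'I_2 & 'I_2.

Definition basis_vec (R : realType) (L : vectType R) (g : hs3_generators L)
    (l : label) : L :=
  match l with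
  | LJ => gJ1 g ord0
  | LG a => gJ1 g (sp a)
  | LH => gP1 g ord0
  | LP a => gP1 g (sp a)
  | LJv a => gJ2 g ord0 (sp a)
  | LGG a b => gJ2 g (sp a) (sp b)
  | LHv a => gP2 g ord0 (sp a)
  | LPP a b => gP2 g (sp a) (sp b)
  end.

Definition all1 (c : 'I_2 -> label) : seq label := [seq c a | a : 'I_2].
Definition all2 (c : 'I_2 -> 'I_2 -> label) : seq label :=
  [seq c a b | a <- enum 'I_2, b <- enum 'I_2].

Definition span_labels (R : realType) (L : vectType R) (g : hs3_generators L)
    (s : seq label) : {vspace L} :=
  <<[seq basis_vec g l | l <- s]>>%VS.

Definition h1 : seq label := [:: LJ] ++ all1 LG ++ all1 LJv ++ all2 LGG.
Definition i1 : seq label := [:: LH] ++ all1 LP ++ all1 LHv ++ all2 LPP.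

Definition h5 : seq label := [:: LJ] ++ all1 LP ++ all1 LJv ++ all2 LPP.
Definition i5 : seq label := all1 LG ++ [:: LH] ++ all1 LHv ++ all2 LGG.

Definition h6 : seq label := [:: LJ] ++ all1 LP ++ all1 LHv ++ all2 LGG.
Definition i6 : seq label := all1 LG ++ [:: LH] ++ all1 LJv ++ all2 LPP.

Section Contractions.
Variables (R : realType) (L : vectType R) (br : L -> L -> L).
Variable g : hs3_generators L.

Definition procedure (h i : seq label) (b : L -> L -> L) : L -> L -> L :=
  contraction b (span_labels g h) (span_labels g i).

Definition procedure_applies (h i : seq label) (b : L -> L -> L) : Prop :=
  is_decomposition b (span_labels g h) (span_labels g i).

Definition hs3car1 : L -> L -> L := procedure h5 i5 (procedure h1 i1 br).
Definition hs3car2 : L -> L -> L := procedure h6 i6 (procedure h1 i1 br).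

End Contractions.

Definition metric_component (R : realType) (l m : label) : R :=
  match l, m with
  | LH, LJ | LJ, LH => -1
  | LP a, LG b | LG b, LP a => delta a b
  | LHv a, LJv b | LJv b, LHv a => - delta a b
  | LPP a b, LGG c d | LGG c d, LPP a b =>
      delta a c * delta d b + delta a d * delta c b
      - 2%:R / 3%:R * delta a b * delta c d
  | _, _ => 0
  end.
Arguments metric_component {R} l m.

Definition has_metric_components (R : realType) (L : vectType R)
    (g : hs3_generators L) (B : L -> L -> R) : Prop :=
  forall l m, B (basis_vec g l) (basis_vec g m) = metric_component l m.

(* Main.v *)
(** Let b be an invariant Lie bracket on h + i with h a subalgebra and h, i both
    isotropic. Invariance says that B([x, y], z) is totally antisymmetric, and
    contracting keeps exactly its components with two arguments in h and one in
    i. Hence contraction preserves invariance, and in fact invariance of b on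
    h x h x i already suffices. The stated metric makes both halves of each of
    the three decompositions isotropic, so a single check on h1 x h1 x i1
    propagates to both Carroll algebras. Isotropy and nondegeneracy also make
    the sums direct.

    That h5 and h6 are subalgebras follows from a Z/2-grading: epsilon_{ABC}
    vanishes unless exactly one of its indices is the time index, and eta_{AB}
    vanishes unless A = B. *)

Require Import Defs.
From HB Require Import structures.
From mathcomp Require Import all_boot all_order all_algebra.
From mathcomp Require Import reals.
From mathcomp Require Import ring lra.

Set Implicit Arguments.
Unset Strict Implicit.
Unset Printing Implicit Defensive.

Import GRing.Theory Num.Theory.
Import Defs.
Local Open Scope ring_scope.

(** * Contractions of Lie brackets *)

(** Vectors of a span are finite linear combinations, so linear properties pass from generators to
    the span; bilinear and trilinear identities are handled one argument at a time. *)
Lemma span_ind (R : fieldType) (L : vectType R) (X : seq L) (P : L -> Prop) :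
  P 0 -> (forall a u v, P u -> P v -> P (a *: u + v)) ->
  {in X, forall v, P v} -> {in <<X>>%VS, forall v, P v}.
Proof.
move=> P0 PD PX v; rewrite -[X]in_tupleE => /coord_span->.
elim/big_ind: _ => // [x y Px Py | i _]; first by rewrite -[x]scale1r; apply: PD.
by rewrite -[_ *: _]addr0; apply: PD => //; apply/PX/mem_nth; case: i.
Qed.

Lemma exists_symmetric_form (R : fieldType) (L : vectType R) (n : nat)
    (X : n.-tuple L) (M : 'I_n -> 'I_n -> R) :
  free X -> (forall i j, M i j = M j i) ->
  exists B : {symmetric L}, forall i j : 'I_n, B X`_i X`_j = M i j.
Proof.
move=> freeX symM.
pose f (x y : L) := \sum_i \sum_j coord X i x * coord X j y * M i j.
(* Symmetric forms are the Hermitian forms with sign exponent [false] and conjugation [idfun], so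
   symmetry is needed in this shape. *)
have fC x y : f x y = (-1) ^+ false * idfun (f y x).
  rewrite expr0 mul1r /f /= exchange_big; apply: eq_bigr => i _.
  by apply: eq_bigr => j _; rewrite symM [coord X j x * _]mulrC.
have linl y : GRing.linear_for ( *%R) (f ^~ y).
  move=> a u v; rewrite /f mulr_sumr -big_split; apply: eq_bigr => i _.
  rewrite mulr_sumr -big_split; apply: eq_bigr => j _ /=.
  by rewrite linearP /=; ring.
have linr x : GRing.linear_for (idfun \; *%R) (f x).
  move=> a u v; have fE z w : f z w = f w z by rewrite fC expr0 mul1r.
  by rewrite ![f x _]fE linl.
pose bil := bilinear_isBilinear.Build R L L R
  (GRing.Scale.Law.clone _ _ ( *%R ) _)
  (GRing.Scale.Law.clone _ _ (idfun \; *%R ) _) f (linl, linr).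
pose herm := isHermitianSesquilinear.Build R L false idfun f fC.
pose B : {symmetric L} := HB.pack f bil herm.
exists B => i j; rewrite /= /f (bigD1 i) //= (bigD1 j) //= !coord_free // !eqxx.
rewrite big1 => [|k /negPf nkj]; last first.
  by rewrite !coord_free // [j == k]eq_sym nkj mulr0 mul0r.
rewrite big1 => [|k /negPf nki]; first by rewrite !mul1r !addr0.
by rewrite big1 // => l _; rewrite !coord_free // [i == k]eq_sym nki !mul0r.
Qed.

Section LieBracket.
Variables (R : realType) (L : vectType R) (br : L -> L -> L).
Hypothesis br_lie : is_lie_bracket br.

Lemma lieDl x y z : br (x + y) z = br x z + br y z.
Proof. by have := lie_linearl br_lie z 1 x y; rewrite !scale1r. Qed.

Lemma lieDr x y z : br x (y + z) = br x y + br x z.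
Proof. by have := lie_linearr br_lie x 1 y z; rewrite !scale1r. Qed.

Lemma lie0r x : br x 0 = 0.
Proof. by have := lieDr x 0 0; rewrite addr0 -[LHS]addr0 => /addrI. Qed.

Lemma lie0l x : br 0 x = 0.
Proof. by have := lieDl 0 0 x; rewrite addr0 -[LHS]addr0 => /addrI. Qed.

Lemma lieC x y : br x y = - br y x.
Proof.
have := lie_alternating br_lie (x + y).
by rewrite lieDl !lieDr !(lie_alternating br_lie) add0r addr0 => /eqP;
  rewrite addr_eq0 => /eqP.
Qed.

Lemma lie_mem_sym (V : {vspace L}) x y : br x y \in V -> br y x \in V.
Proof. by rewrite lieC memvN. Qed.

Lemma lie_span_mem (X Y : seq L) (V : {vspace L}) :
  {in X & Y, forall x y, br x y \in V} ->
  {in <<X>>%VS & <<Y>>%VS, forall x y, br x y \in V}.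
Proof.
move=> brV x y xX yY; move: x xX; apply: span_ind.
- by apply: lie_mem_sym; rewrite lie0r mem0v.
- by move=> a u v uV vV; rewrite (lie_linearl br_lie) memvD ?memvZ.
move=> x xX; move: y yY; apply: span_ind => [|a u v uV vV|y yY].
- by rewrite lie0r mem0v.
- by rewrite (lie_linearr br_lie) memvD ?memvZ.
exact: brV.
Qed.

End LieBracket.

Section Contraction.
Variables (R : realType) (L : vectType R) (br : L -> L -> L).
Variables (h i : {vspace L}).
Hypothesis br_lie : is_lie_bracket br.
Hypothesis br_dec : is_decomposition br h i.

Local Notation p := (daddv_pi h i).
Local Notation q := (daddv_pi i h).
Local Notation br' := (contraction br h i).

Let hi0 : (h :&: i)%VS = 0%VS.
Proof. by case: br_dec => _ /directv_addP. Qed.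

Let ih0 : (i :&: h)%VS = 0%VS. Proof. by rewrite capvC. Qed.

Let pq x : p x + q x = x.
Proof. by case: br_dec => hi _ _; rewrite daddv_pi_add // hi memvf. Qed.

Let ph x : p x \in h. Proof. exact: memv_pi. Qed.
Let qi x : q x \in i. Proof. exact: memv_pi. Qed.
Let p_id x : x \in h -> p x = x. Proof. exact: daddv_pi_id. Qed.
Let q_id x : x \in i -> q x = x. Proof. exact: daddv_pi_id. Qed.

Let p_i x : x \in i -> p x = 0.
Proof. by move=> /q_id qx; apply: (addIr (q x)); rewrite pq add0r. Qed.

Let q_h x : x \in h -> q x = 0.
Proof. by move=> /p_id px; apply: (addrI (p x)); rewrite pq addr0. Qed.

Let hh x y : x \in h -> y \in h -> br x y \in h.
Proof. by case: br_dec => _ _; apply. Qed.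

Lemma contraction_hh x y : x \in h -> y \in h -> br' x y = br x y.
Proof.
move=> xh yh; rewrite /contraction (p_id xh) (p_id yh) (q_h xh) (q_h yh).
by rewrite (lie0l br_lie) (lie0r br_lie) linear0 !addr0.
Qed.

Lemma contraction_hi x y : x \in h -> y \in i -> br x y \in i -> br' x y = br x y.
Proof.
move=> xh yi xyi; rewrite /contraction (p_id xh) (p_i yi) (q_h xh) (q_id yi).
by rewrite (q_id xyi) (lie0l br_lie) (lie0r br_lie) linear0 addr0 add0r.
Qed.

Lemma contraction_ii x y : x \in i -> y \in i -> br' x y = 0.
Proof.
move=> xi yi; rewrite /contraction (p_i xi) (p_i yi).
by rewrite !(lie0l br_lie) (lie0r br_lie) linear0 !addr0.
Qed.

Let p_i_q w : p (q w) = 0. Proof. exact: p_i. Qed.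

Let p_br x y : p (br' x y) = br (p x) (p y).
Proof. by rewrite /contraction !linearD /= p_id ?hh ?ph // !p_i_q !addr0. Qed.

Let q_br x y : q (br' x y) = q (br (p x) (q y) + br (q x) (p y)).
Proof.
rewrite /contraction !linearD /= q_h ?hh ?ph // add0r.
by congr (_ + _); rewrite q_id ?qi.
Qed.

(* q [x, q w] = q [x, w] for x in h, because [x, p w] stays in h. *)
Let q_brq x w : q (br (p x) (q w)) = q (br (p x) w).
Proof.
rewrite -{2}[w]pq (lieDr br_lie) [RHS]linearD /=.
by rewrite [q _ in RHS]q_h ?hh ?ph // add0r.
Qed.

(** A double contracted bracket consists of the part with all arguments in [h] and the [i]-component
    of the part with exactly one argument in [i]. The Jacobi identity of [br] kills the cyclic sum
    of each. *)
Lemma contraction_lie : is_lie_bracket br'.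
Proof.
have antisym x y : br' x y = - br' y x.
  rewrite /contraction (lieC br_lie (p x)) (lieC br_lie (p x) (q y)).
  by rewrite (lieC br_lie (q x)) !linearN /= -!opprD addrAC.
have linl y : linear (br'^~ y).
  move=> a u v; rewrite /contraction !linearP !(lie_linearl br_lie) !linearP /=.
  by rewrite 2!scalerDr (AC ((2*2)*2) (((1*3)*5)*((2*4)*6))) /=.
split=> //.
- by move=> x a u v; rewrite ![br' x _]antisym linl opprD scalerN.
- move=> x; rewrite /contraction lie_alternating // add0r -linearD /=.
  by rewrite (lieC br_lie (p x)) addNr linear0.
move=> x y z.
have E a b c : br' a (br' b c) = br (p a) (br (p b) (p c))
    + q (br (p a) (br (p b) (q c)) + br (p a) (br (q b) (p c))
       + br (q a) (br (p b) (p c))).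
  rewrite {1}/contraction p_br q_br q_brq -addrA; congr (_ + _).
  by rewrite -linearD /= (lieDr br_lie).
have J a b c := lie_jacobi br_lie a b c.
rewrite !E (AC ((2*2)*2) (((1*3)*5)*((2*4)*6))) /= J add0r -!linearD /=.
(* The nine terms are grouped by which of [z], [y], [x] supplies the component in [i]; each group is
   one Jacobi sum. *)
rewrite (AC ((3*3)*3) (((1*5*9)*(2*6*7))*(3*4*8))) /= !J !addr0.
exact: linear0.
Qed.

Variable B : {symmetric L}.
Hypothesis h_isotropic : {in h &, forall x y, B x y = 0}.
Hypothesis i_isotropic : {in i &, forall x y, B x y = 0}.

Let BC x y : B x y = B y x.
Proof. by rewrite hermC expr0 mul1r. Qed.

Lemma contraction_ad_invariant :
  (forall x y u, x \in h -> y \in h -> u \in i -> B (br x y) u = B x (br y u)) ->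
  ad_invariant br' B.
Proof.
move=> hhi.
have BNl x y : B (- x) y = - B x y by rewrite linearNl.
have BNr x y : B x (- y) = - B x y by rewrite linearNr.
(* Antisymmetry of [br] and symmetry of [B] move the argument from [i] into the other slots. *)
have hih x u y : x \in h -> u \in i -> y \in h -> B (br x u) y = B x (br u y).
  move=> xh ui yh; rewrite (lieC br_lie u) BNr -hhi // (lieC br_lie x y) BNl.
  by rewrite opprK [RHS]hhi // BC.
have cyc x y u : x \in h -> y \in h -> u \in i ->
    B (br u x) y = B (br x y) u.
  by move=> xh yh ui; rewrite (lieC br_lie u) BNl hih // (lieC br_lie u) BNr
    opprK hhi //.
have E x y z : B (br' x y) z = B (br (p x) (p y)) (q z)
    + B (br (p x) (q y)) (p z) + B (br (q x) (p y)) (p z).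
  (* Isotropy of both halves makes [q] the adjoint of [p] with respect to [B]. *)
  have qE w : B (q w) z = B w (p z).
    rewrite -{1}[z]pq linearDr /= [B (q w) (q z)]i_isotropic ?qi // addr0.
    by rewrite -{2}[w]pq linearDl /= [B (p w) (p z)]h_isotropic ?ph // add0r.
  rewrite /contraction !linearDl /= !qE -{1}[z]pq linearDr /=.
  by rewrite [B _ (p z)]h_isotropic ?hh ?ph // add0r.
move=> x y z; rewrite [RHS]BC !E.
have cyc1 : B (br (q x) (p y)) (p z) = B (br (p y) (p z)) (q x).
  by rewrite cyc.
rewrite cyc1 [B (br (p y) (q z)) _]hih // [B (p y) _]BC [B _ (p y)]cyc //.
rewrite [B (br (p x) (q y)) _]hih // [B (p x) _]BC.
by rewrite (AC (3%N) ((3*1)*2)).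
Qed.

End Contraction.

(** * Labels and generators *)

(** An injection through which [label] inherits decidable equality; index slots that a label lacks
    are filled with [ord0]. *)
Definition label_code (l : label) : nat * 'I_2 * 'I_2 :=
  match l with
  | LJ => (0, ord0, ord0) | LG a => (1, a, ord0) | LH => (2, ord0, ord0)
  | LP a => (3, a, ord0) | LJv a => (4, a, ord0) | LGG a b => (5, a, b)
  | LHv a => (6, a, ord0) | LPP a b => (7, a, b)
  end.

Definition label_decode (c : nat * 'I_2 * 'I_2) : label :=
  let: (n, a, b) := c in
  match n with
  | 0 => LJ | 1 => LG a | 2 => LH | 3 => LP a
  | 4 => LJv a | 5 => LGG a b | 6 => LHv a | _ => LPP a b
  end.

Lemma label_codeK : cancel label_code label_decode.
Proof. by case. Qed.

HB.instance Definition _ := Equality.copy label (can_type label_codeK).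

Lemma mem_all1 (c : 'I_2 -> label) (a : 'I_2) : c a \in all1 c.
Proof. by rewrite map_f ?mem_enum. Qed.

Lemma mem_all2 (c : 'I_2 -> 'I_2 -> label) (a b : 'I_2) :
  c a b \in all2 c.
Proof. by apply: allpairs_f; rewrite mem_enum. Qed.

Lemma all_all1 (p : pred label) (c : 'I_2 -> label) :
  all p (all1 c) = [forall a, p (c a)].
Proof.
apply/allP/forallP => [pc a|pc l /mapP[a _ ->] //]; exact/pc/mem_all1.
Qed.

Lemma all_all2 (p : pred label) (c : 'I_2 -> 'I_2 -> label) :
  all p (all2 c) = [forall a, forall b, p (c a b)].
Proof.
apply/allP/forallP => [pc a|pc l /allpairsP[[a b] [_ _ ->]]].
  by apply/forallP=> b; exact/pc/mem_all2.
exact: (forallP (pc a)).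
Qed.

(** Boolean forms of the lists [h1], [h5] and [h6], suited to case analysis; [i1], [i5] and [i6]
    correspond to the complements. *)
Definition in_h1 (l : label) : bool :=
  match l with LJ | LG _ | LJv _ | LGG _ _ => true | _ => false end.
Definition in_h5 (l : label) : bool :=
  match l with LJ | LP _ | LJv _ | LPP _ _ => true | _ => false end.
Definition in_h6 (l : label) : bool :=
  match l with LJ | LP _ | LHv _ | LGG _ _ => true | _ => false end.

Definition enumerates (s : seq label) (p : pred label) : Prop :=
  all p s /\ forall l, p l -> l \in s.

Ltac prove_enumerates :=
  split;
  [ by rewrite /= ?all_cat ?all_all1 ?all_all2 /=;
    repeat (apply/andP; split); repeat (apply/forallP => ?)
  | by case=> [|a||a|a|a b|a|a b] //= _; rewrite !(mem_cat, inE);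
    rewrite ?(mem_all1, mem_all2) ?orbT ].

Lemma enumerates_h1 : enumerates h1 in_h1. Proof. prove_enumerates. Qed.
Lemma enumerates_i1 : enumerates i1 (predC in_h1). Proof. prove_enumerates. Qed.
Lemma enumerates_h5 : enumerates h5 in_h5. Proof. prove_enumerates. Qed.
Lemma enumerates_i5 : enumerates i5 (predC in_h5). Proof. prove_enumerates. Qed.
Lemma enumerates_h6 : enumerates h6 in_h6. Proof. prove_enumerates. Qed.
Lemma enumerates_i6 : enumerates i6 (predC in_h6). Proof. prove_enumerates. Qed.

(** Covariant names for all generators, including the time-time components and both index orders.
    The brackets are uniform in these names, whereas labels would split each rule into time and
    space cases. *)
Inductive gen :=
  | GJ1 of 'I_3 | GP1 of 'I_3 | GJ2 of 'I_3 & 'I_3 | GP2 of 'I_3 & 'I_3.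

Definition gen_of_label (l : label) : gen :=
  match l with
  | LJ => GJ1 ord0 | LG a => GJ1 (sp a) | LH => GP1 ord0 | LP a => GP1 (sp a)
  | LJv a => GJ2 ord0 (sp a) | LGG a b => GJ2 (sp a) (sp b)
  | LHv a => GP2 ord0 (sp a) | LPP a b => GP2 (sp a) (sp b)
  end.

Definition gen_vec (R : realType) (L : vectType R) (g : hs3_generators L)
    (x : gen) : L :=
  match x with
  | GJ1 A => gJ1 g A | GP1 A => gP1 g A
  | GJ2 A B => gJ2 g A B | GP2 A B => gP2 g A B
  end.

Lemma basis_vecE (R : realType) (L : vectType R) (g : hs3_generators L) l :
  basis_vec g l = gen_vec g (gen_of_label l).
Proof. by case: l. Qed.

Variant index_spec : 'I_3 -> bool -> Type :=
  | IndexTime : index_spec ord0 true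
  | IndexSpace a : index_spec (sp a) false.

Lemma indexP A : index_spec A (A == ord0).
Proof.
case: (unliftP ord0 A) => [a|] ->; last by rewrite eqxx; constructor.
by rewrite eq_sym (negPf (neq_lift _ _)); constructor.
Qed.

Definition is_J (x : gen) : bool :=
  match x with GJ1 _ | GJ2 _ _ => true | _ => false end.

(* The degree-0 part of the grading, which is h5 for [e = false] and h6 for
   [e = true]. *)
Definition parity (e : bool) (x : gen) : bool :=
  match x with
  | GJ1 A => A == ord0
  | GP1 A => A != ord0
  | GJ2 A B => (A == ord0) (+) (B == ord0) (+) e
  | GP2 A B => ~~ ((A == ord0) (+) (B == ord0) (+) e)
  end.

Lemma is_J_label l : is_J (gen_of_label l) = in_h1 l.
Proof. by case: l. Qed.

Lemma sp_neq0 a : (sp a == ord0) = false.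
Proof. by rewrite eq_sym (negPf (neq_lift _ _)). Qed.

Lemma parity_label e l :
  parity e (gen_of_label l) = if e then in_h6 l else in_h5 l.
Proof. by case: l => *; case: e; rewrite /= ?sp_neq0. Qed.

(** Compatibility with the linear relations among generators: symmetry, and the tracelessness
    relation expressing the time-time component through the diagonal spatial ones. *)
Definition tensor_compatible (p : pred gen) : Prop :=
  [/\ forall A B, p (GJ2 A B) = p (GJ2 B A),
      forall A B, p (GP2 A B) = p (GP2 B A),
      forall a, p (GJ2 (sp a) (sp a)) = p (GJ2 ord0 ord0)
    & forall a, p (GP2 (sp a) (sp a)) = p (GP2 ord0 ord0)].

Lemma tensor_compatible_is_J : tensor_compatible is_J.
Proof. by []. Qed.

Lemma tensor_compatible_parity e : tensor_compatible (parity e).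
Proof.
by split=> [A B|A B|a|a] /=; rewrite ?sp_neq0 // (addbC (A == _)).
Qed.

Lemma tensor_compatibleC p : tensor_compatible p -> tensor_compatible (predC p).
Proof.
by case=> J P J0 P0; split=> [A B|A B|a|a] /=; rewrite ?J0 ?P0 // (J, P).
Qed.

Lemma sum_eta_trace (R : realType) (V : lmodType R) (T : 'I_3 -> 'I_3 -> V) :
  \sum_(A < 3) \sum_(B < 3) eta A B *: T A B
    = - T ord0 ord0 + \sum_(a < 2) T (sp a) (sp a).
Proof.
have E A : \sum_(B < 3) eta A B *: T A B
    = (if A == ord0 then -1 else 1 : R) *: T A A.
  rewrite (bigD1 A) //= big1 ?addr0 => [|B nBA]; first by rewrite /eta eqxx.
  by rewrite /eta eq_sym (negPf nBA) scale0r.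
rewrite (eq_bigr _ (fun A _ => E A)) big_ord_recl eqxx scaleN1r; congr (_ + _).
by apply: eq_bigr => a _; rewrite -/(sp a) sp_neq0 scale1r.
Qed.

(** * Generators expressed through the labelled vectors *)

Section Generators.
Variables (R : realType) (L : vectType R) (s : background) (br : L -> L -> L).
Variable g : hs3_generators L.
Hypothesis hs3 : is_hs3 s br g.

Lemma J2_time_time : gJ2 g ord0 ord0 = \sum_(a < 2) gJ2 g (sp a) (sp a).
Proof.
have := hs3_J2_tr hs3; rewrite sum_eta_trace addrC => /eqP.
by rewrite subr_eq0 => /eqP.
Qed.

Lemma P2_time_time : gP2 g ord0 ord0 = \sum_(a < 2) gP2 g (sp a) (sp a).
Proof.
have := hs3_P2_tr hs3; rewrite sum_eta_trace addrC => /eqP.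
by rewrite subr_eq0 => /eqP.
Qed.

(** Only the space-time and time-time components carry no label: symmetry reduces the former to
    labelled vectors, tracelessness the latter. *)
Lemma gen_vec_mem (p : pred gen) (V : {vspace L}) :
  tensor_compatible p ->
  (forall l, p (gen_of_label l) -> basis_vec g l \in V) ->
  forall x, p x -> gen_vec g x \in V.
Proof.
move=> [pJ pP pJ0 pP0] pV [A|A|A B|A B] /=.
- by case: (indexP A) => [/(pV LJ)|a /(pV (LG a))].
- by case: (indexP A) => [/(pV LH)|a /(pV (LP a))].
- case: (indexP A) (indexP B) => [|a] [|b].
  + move=> p0; rewrite J2_time_time memv_suml // => a _.
    by apply: (pV (LGG a a)); rewrite /= pJ0.
  + exact: (pV (LJv b)).
  + by rewrite pJ (hs3_J2_sym hs3); apply: (pV (LJv a)).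
  exact: (pV (LGG a b)).
case: (indexP A) (indexP B) => [|a] [|b].
+ move=> p0; rewrite P2_time_time memv_suml // => a _.
  by apply: (pV (LPP a a)); rewrite /= pP0.
+ exact: (pV (LHv b)).
+ by rewrite pP (hs3_P2_sym hs3); apply: (pV (LHv a)).
exact: (pV (LPP a b)).
Qed.

Lemma basis_vec_mem_span (t : seq label) l :
  l \in t -> basis_vec g l \in span_labels g t.
Proof. by move=> lt; rewrite memv_span ?map_f. Qed.

Lemma span_generators (V : {vspace L}) :
  (forall l, basis_vec g l \in V) -> V = fullv.
Proof.
move=> lV; apply/eqP; rewrite eqEsubv subvf /= -(hs3_span hs3).
have gV x : gen_vec g x \in V by apply: (@gen_vec_mem predT).
apply/span_subvP=> v; rewrite !mem_cat.
case/or4P=> [/mapP[A _ ->]|/mapP[A _ ->]|/allpairsP|/allpairsP].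
- exact: (gV (GJ1 A)).
- exact: (gV (GP1 A)).
- by case=> [[A B] [_ _ ->]]; apply: (gV (GJ2 A B)).
by case=> [[A B] [_ _ ->]]; apply: (gV (GP2 A B)).
Qed.

End Generators.

(** * The tensors eta and epsilon *)

(** Quantification over ['I_3] as a closed boolean, so that nested index identities can be
    evaluated. *)
Definition below3 (P : nat -> bool) : bool := [&& P 0, P 1 & P 2].

Lemma below3P (P : nat -> bool) : below3 P -> forall A : 'I_3, P A.
Proof. by case/and3P=> P0 P1 P2 [[|[|[|//]]] ?]. Qed.

(* Integer versions of the tensors, so that identities over all index values are
   decided by computation; [kappaz] is three times [kappa]. *)
Definition etaz (a b : nat) : int :=
  if a == b then (if a == 0 then -1 else 1) else 0.

Definition epsz (a b c : nat) : int :=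
  (((b%:Z - a%:Z) * (c%:Z - a%:Z) * (c%:Z - b%:Z)) %/ 2)%Z.

Definition sum3 (V : nmodType) (f : nat -> V) : V := f 0%N + f 1%N + f 2%N.

Lemma sum3E (V : nmodType) (f : nat -> V) : \sum_(M < 3) f M = sum3 f.
Proof. by rewrite !big_ord_recl big_ord0 /= addr0 addrA. Qed.

Section IntegerTensors.
Variable R : realType.

Lemma etaE (A B : 'I_3) : eta A B = (etaz A B)%:~R :> R.
Proof. by rewrite /eta /etaz -!val_eqE /=; do 2?case: ifP. Qed.

Lemma epsE (A B C : 'I_3) : eps A B C = (epsz A B C)%:~R :> R.
Proof.
(* The integer division in [epsz] is exact: the product of differences is even for all index
   values. *)
have E : epsz A B C * 2 = (B%:Z - A%:Z) * (C%:Z - A%:Z) * (C%:Z - B%:Z).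
  have /below3P/(_ A)/below3P/(_ B)/below3P/(_ C)/eqP// : below3 (fun a =>
    below3 (fun b => below3 (fun c => epsz a b c * 2 ==
      (b%:Z - a%:Z) * (c%:Z - a%:Z) * (c%:Z - b%:Z)))) by vm_compute.
rewrite /eps; apply: (canLR (mulfK _)); first by rewrite pnatr_eq0.
have /(congr1 (fun z => z%:~R : R)) := E.
by rewrite !(rmorphM, rmorphB) /= => ->.
Qed.

(** The Lorentz-covariant extension of the stated pairing of [P_ab] with [G_cd]. The coefficient 2/3
    is 2 over the spacetime dimension, which makes it trace-free; its components with indices [0a],
    [0b] reproduce the pairing of [H_a] with [J_b]. *)
Definition kappa (A B C D : 'I_3) : R :=
  eta A C * eta D B + eta A D * eta C B - 2 / 3 * eta A B * eta C D.

Lemma eta_sym (A B : 'I_3) : eta A B = eta B A :> R.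
Proof. by rewrite /eta eq_sym; case: eqP => // ->. Qed.

Lemma kappa_symr A B C D : kappa A B C D = kappa A B D C.
Proof. by rewrite /kappa [eta D C]eta_sym; ring. Qed.

Lemma kappaC A B C D : kappa A B C D = kappa C D A B.
Proof.
by rewrite /kappa [eta D B]eta_sym [eta A C]eta_sym [eta A D]eta_sym
  [eta C B]eta_sym; ring.
Qed.

Lemma kappa_trace A B :
  kappa A B ord0 ord0 = \sum_(a < 2) kappa A B (sp a) (sp a).
Proof.
rewrite /kappa !big_ord_recl big_ord0; case: (indexP A) (indexP B) => [|a] [|b];
  by rewrite /eta /=; try case: a => [[|[|//]] ?]; try case: b => [[|[|//]] ?];
  rewrite /eq_op /=; lra.
Qed.

Definition kappaz (a b c d : nat) : int :=
  3 * (etaz a c * etaz d b + etaz a d * etaz c b) - 2 * (etaz a b * etaz c d).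

Lemma kappaE A B C D : kappa A B C D = (kappaz A B C D)%:~R / 3 :> R.
Proof.
by rewrite /kappa /kappaz !etaE !(rmorphD, rmorphM, rmorphN) /=; field.
Qed.

Definition eps_upz (m a b : nat) : int := sum3 (fun n => etaz m n * epsz n a b).

Lemma eps_upE M A B : eps_up M A B = (eps_upz M A B)%:~R :> R.
Proof.
rewrite /eps_up /eps_upz -sum3E rmorph_sum /=.
by apply: eq_bigr => N _; rewrite etaE epsE rmorphM.
Qed.

(** The number [B([J_A, J_BC], P_DE)]; [tensor_bracket] below is [B(J_A, [J_BC, P_DE])]. *)
Definition tensor_action (A B C D E : 'I_3) : R :=
  \sum_(M < 3) (eps_up M A B * kappa C M D E + eps_up M A C * kappa B M D E).

Definition tensor_bracket (A B C D E : 'I_3) : R :=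
  - \sum_(M < 3) sym_nested (fun A' C' D' B' => eta A' C' * eps D' B' M) B D E C
      * \sum_(N < 3) eta M N * eta A N.

Definition tensor_actionz (a b c d e : nat) : int :=
  sum3 (fun m => eps_upz m a b * kappaz c m d e + eps_upz m a c * kappaz b m d e).

Definition nestedz (b d e c m : nat) : int :=
  etaz b d * epsz e c m + etaz b e * epsz d c m
  + etaz c d * epsz e b m + etaz c e * epsz d b m.

Definition tensor_bracketz (a b c d e : nat) : int :=
  - sum3 (fun m => nestedz b d e c m * sum3 (fun n => etaz m n * etaz a n)).

Lemma tensor_actionE A B C D E :
  tensor_action A B C D E = (tensor_actionz A B C D E)%:~R / 3.
Proof.
rewrite /tensor_action /tensor_actionz -sum3E rmorph_sum mulr_suml.
apply: eq_bigr => M _; rewrite !kappaE !eps_upE !(rmorphD, rmorphM) /=.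
by ring.
Qed.

Lemma tensor_bracketE A B C D E :
  tensor_bracket A B C D E = (tensor_bracketz A B C D E)%:~R.
Proof.
rewrite /tensor_bracket /tensor_bracketz rmorphN -sum3E rmorph_sum; congr (- _).
apply: eq_bigr => M _; rewrite rmorphM -sum3E rmorph_sum; congr (_ * _).
  by rewrite /sym_nested /nestedz !etaE !epsE !(rmorphD, rmorphM).
by apply: eq_bigr => N _; rewrite !etaE rmorphM.
Qed.

(** This is invariance of the metric on [J_A], [J_BC], [P_DE]. Multiplied by 3 it becomes an integer
    identity, evaluated at all 3^5 index values. *)
Lemma tensor_action_bracket A B C D E :
  tensor_action A B C D E = tensor_bracket A B C D E.
Proof.
rewrite tensor_actionE tensor_bracketE; apply: (canLR (mulfK _)).
  by rewrite pnatr_eq0.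
have /below3P/(_ A)/below3P/(_ B)/below3P/(_ C)/below3P/(_ D)/below3P/(_ E)/eqP -> :
  below3 (fun a => below3 (fun b => below3 (fun c => below3 (fun d =>
   below3 (fun e => tensor_actionz a b c d e == tensor_bracketz a b c d e * 3)))))
  by vm_compute.
by rewrite rmorphM.
Qed.

(** Lorentz invariance of [kappa]: each [J_A] acts on symmetric tensors by a map antisymmetric for
    [kappa]. *)
Lemma tensor_action_antisym A B C D E :
  tensor_action A B C D E = - tensor_action A D E B C.
Proof.
rewrite !tensor_actionE -mulNr -rmorphN; congr (_ %:~R / _); apply/eqP.
by have /below3P/(_ A)/below3P/(_ B)/below3P/(_ C)/below3P/(_ D)/below3P/(_ E) :
  below3 (fun a => below3 (fun b => below3 (fun c => below3 (fun d =>
   below3 (fun e => tensor_actionz a b c d e == - tensor_actionz a d e b c)))))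
  by vm_compute.
Qed.

Lemma eps_cyclic A B C : eps A B C = eps B C A :> R.
Proof.
rewrite !epsE; congr (_%:~R); apply/eqP.
by have /below3P/(_ A)/below3P/(_ B)/below3P/(_ C) :
  below3 (fun a => below3 (fun b => below3 (fun c => epsz a b c == epsz b c a)))
  by vm_compute.
Qed.

(** With no time index, or with two, some index value repeats. *)
Lemma eps_parity A B C :
  ~~ ((A == ord0) (+) (B == ord0) (+) (C == ord0)) -> eps A B C = 0 :> R.
Proof.
rewrite epsE -!val_eqE /=.
have /below3P/(_ A)/below3P/(_ B)/below3P/(_ C)/implyP H :
  below3 (fun a => below3 (fun b => below3 (fun c =>
    ~~ ((a == 0) (+) (b == 0) (+) (c == 0)) ==> (epsz a b c == 0))))
  by vm_compute.
by move=> /H/eqP->.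
Qed.

Lemma eps_up_parity A B C :
  ~~ ((A == ord0) (+) (B == ord0) (+) (C == ord0)) -> eps_up A B C = 0 :> R.
Proof.
move=> p; rewrite /eps_up (bigD1 A) //= eps_parity // mulr0 add0r big1 // => N.
by rewrite /eta eq_sym => /negPf->; rewrite mul0r.
Qed.

End IntegerTensors.

(** * The parity grading *)

Section Membership.
Variables (R : realType) (L : vectType R) (V : {vspace L}).

Lemma raise_mem (X : 'I_3 -> L) A : X A \in V -> raise X A \in V.
Proof.
move=> XA; rewrite /raise memv_suml // => B _; rewrite /eta.
by case: eqP => [<-|_]; rewrite ?scale0r ?mem0v // memvZ.
Qed.

(** Here and in the next two membership lemmas, terms with an even total number of time indices have
    coefficient zero, so [X] need only lie in [V] for the odd ones. Contracted indices occur twice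
    and do not affect the parity. *)
Lemma eps_vec_mem (X : 'I_3 -> L) A B :
  (forall C, (A == ord0) (+) (B == ord0) (+) (C == ord0) -> X C \in V) ->
  eps_vec X A B \in V.
Proof.
move=> XV; rewrite /eps_vec memv_suml // => C _.
have [/XV/raise_mem XC|/eps_parity->] :=
  boolP ((A == ord0) (+) (B == ord0) (+) (C == ord0)).
  by rewrite memvZ.
by rewrite scale0r mem0v.
Qed.

Lemma eps_tens_mem (X : 'I_3 -> 'I_3 -> L) A B C :
  (forall D E, (A == ord0) (+) (B == ord0) (+) (C == ord0) (+)
     (D == ord0) (+) (E == ord0) -> X D E \in V) ->
  eps_tens X A B C \in V.
Proof.
move=> XV; rewrite /eps_tens memv_suml // => M _; rewrite /sym2 /=.
have sub B' C' :
    ((M == ord0) (+) (A == ord0) (+) (B' == ord0) -> X C' M \in V) ->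
    eps_up M A B' *: X C' M \in V.
  move=> XM; have [p|p] := boolP ((M == ord0) (+) (A == ord0) (+) (B' == ord0)).
    by rewrite memvZ ?XM.
  by rewrite eps_up_parity // scale0r mem0v.
rewrite memvD //; apply: sub => p; apply: XV; move: p;
  by do !case: (_ == ord0).
Qed.

Lemma eta_eps_vec_mem (X : 'I_3 -> L) A B C D :
  (forall E, (A == ord0) (+) (B == ord0) (+) (C == ord0) (+)
     (D == ord0) (+) (E == ord0) -> X E \in V) ->
  eta_eps_vec X A B C D \in V.
Proof.
move=> XV; rewrite /eta_eps_vec memv_suml // => M _; rewrite /sym_nested /=.
have [/XV/raise_mem XM|p] := boolP ((A == ord0) (+) (B == ord0) (+) (C == ord0)
    (+) (D == ord0) (+) (M == ord0)); first by rewrite memvZ.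
have sub A' C' D' B' : ~~ ((A' == ord0) (+) (B' == ord0) (+) (C' == ord0)
    (+) (D' == ord0) (+) (M == ord0)) -> eta A' C' * eps D' B' M = 0 :> R.
  rewrite /eta; case: (eqVneq A' C') => [->|_]; last by rewrite mul0r.
  move=> q; rewrite eps_parity ?mulr0 //.
  by move: q; do !case: (_ == ord0).
rewrite !sub ?addr0 ?scale0r ?mem0v //; move: p; by do !case: (_ == ord0).
Qed.

End Membership.

(** * Bracket relations with a variable coefficient, their grading and their contraction *)

Section BracketTable.
Variables (R : realType) (L : vectType R) (g : hs3_generators L).

(* [c = 1] and [c = -1] are the AdS and dS brackets; [c = 0] is what remains
   after procedure 1. *)
Record bracket_table (c : R) (b : L -> L -> L) : Prop := BracketTable {
  tabJ1J1 : forall A B, b (gJ1 g A) (gJ1 g B) = eps_vec (gJ1 g) A B;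
  tabJ1P1 : forall A B, b (gJ1 g A) (gP1 g B) = eps_vec (gP1 g) A B;
  tabP1P1 : forall A B, b (gP1 g A) (gP1 g B) = c *: eps_vec (gJ1 g) A B;
  tabJ1J2 : forall A B C, b (gJ1 g A) (gJ2 g B C) = eps_tens (gJ2 g) A B C;
  tabJ1P2 : forall A B C, b (gJ1 g A) (gP2 g B C) = eps_tens (gP2 g) A B C;
  tabP1J2 : forall A B C, b (gP1 g A) (gJ2 g B C) = eps_tens (gP2 g) A B C;
  tabP1P2 : forall A B C, b (gP1 g A) (gP2 g B C) = c *: eps_tens (gJ2 g) A B C;
  tabJ2J2 : forall A B C D,
    b (gJ2 g A B) (gJ2 g C D) = - eta_eps_vec (gJ1 g) A B C D;
  tabJ2P2 : forall A B C D,
    b (gJ2 g A B) (gP2 g C D) = - eta_eps_vec (gP1 g) A B C D;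
  tabP2P2 : forall A B C D,
    b (gP2 g A B) (gP2 g C D) = - c *: eta_eps_vec (gJ1 g) A B C D
}.

Lemma hs3_table s br : is_hs3 s br g -> bracket_table (bg_sign s) br.
Proof. by case. Qed.

Variables (c : R) (b : L -> L -> L).
Hypothesis b_lie : is_lie_bracket b.
Hypothesis b_table : bracket_table c b.

Lemma parity_closed (e : bool) (V : {vspace L}) :
  (forall x, parity e x -> gen_vec g x \in V) ->
  forall x y, parity e x -> parity e y -> b (gen_vec g x) (gen_vec g y) \in V.
Proof.
move=> gV.
have J1V A := gV (GJ1 A); have P1V A := gV (GP1 A).
have J2V A B := gV (GJ2 A B); have P2V A B := gV (GP2 A B).
case=> [A|A|A B|A B] [C|C|C D|C D] /= px py.
all: rewrite ?(tabJ1J1 b_table, tabJ1P1 b_table, tabP1P1 b_table, tabJ1J2 b_table,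
  tabJ1P2 b_table, tabP1J2 b_table, tabP1P2 b_table, tabJ2J2 b_table,
  tabJ2P2 b_table, tabP2P2 b_table).
(* The table gives each mixed bracket in one order only; antisymmetry supplies the other. *)
all: try (apply: (lie_mem_sym b_lie);
  rewrite ?(tabJ1P1 b_table, tabJ1J2 b_table, tabJ1P2 b_table, tabP1J2 b_table,
  tabP1P2 b_table, tabJ2P2 b_table)).
all: rewrite ?(memvN, memvZ) //.
all: (try apply: memvZ); first [apply: eps_vec_mem => E | apply: eps_tens_mem => E F
  | apply: eta_eps_vec_mem => E] => pE.
all: first [apply: J1V | apply: P1V | apply: J2V | apply: P2V].
(* What remains is propositional: degrees add up, for either choice of [e]. *)
all: by clear -px py pE; case: e px py pE => /=; do ?case: (_ == ord0).
Qed.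

Lemma J_closed (V : {vspace L}) :
  (forall x, is_J x -> gen_vec g x \in V) ->
  forall x y, is_J x -> is_J y -> b (gen_vec g x) (gen_vec g y) \in V.
Proof.
move=> gV.
have J1J2V A C D : b (gJ1 g A) (gJ2 g C D) \in V.
  by rewrite (tabJ1J2 b_table); apply: eps_tens_mem => E F _; apply: (gV (GJ2 E F)).
case=> [A|//|A B|//] [C|//|C D|//] /= _ _.
- by rewrite (tabJ1J1 b_table); apply: eps_vec_mem => E _; apply: (gV (GJ1 E)).
- exact: J1J2V.
- exact: (lie_mem_sym b_lie).
rewrite (tabJ2J2 b_table) memvN; apply: eta_eps_vec_mem => E _.
exact: (gV (GJ1 E)).
Qed.

Variables h i : {vspace L}.
Hypothesis hE : forall x, is_J x -> gen_vec g x \in h.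
Hypothesis iE : forall x, ~~ is_J x -> gen_vec g x \in i.
Hypothesis b_dec : is_decomposition b h i.

Let J1h A : gJ1 g A \in h. Proof. exact: (hE (x := GJ1 A)). Qed.
Let J2h A B : gJ2 g A B \in h. Proof. exact: (hE (x := GJ2 A B)). Qed.
Let P1i A : gP1 g A \in i. Proof. exact: (iE (x := GP1 A)). Qed.
Let P2i A B : gP2 g A B \in i. Proof. exact: (iE (x := GP2 A B)). Qed.

(** The brackets of a [J] with a [P] already lie in [i] and survive unchanged, so the contraction
    only removes the terms with coefficient [c]. *)
Lemma contraction_table : bracket_table 0 (contraction b h i).
Proof.
have P1 A B : eps_vec (gP1 g) A B \in i by apply: eps_vec_mem.
have P2 A B C : eps_tens (gP2 g) A B C \in i by apply: eps_tens_mem.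
have P3 A B C D : - eta_eps_vec (gP1 g) A B C D \in i.
  by rewrite memvN; apply: eta_eps_vec_mem.
have b'_lie := contraction_lie b_lie b_dec.
split=> *.
- by rewrite contraction_hh // (tabJ1J1 b_table).
- by rewrite contraction_hi // (tabJ1P1 b_table).
- by rewrite (contraction_ii b_lie b_dec) // scale0r.
- by rewrite contraction_hh // (tabJ1J2 b_table).
- by rewrite contraction_hi // (tabJ1P2 b_table).
- rewrite (lieC b'_lie) contraction_hi //.
    by rewrite -(lieC b_lie) (tabP1J2 b_table).
  by rewrite (lieC b_lie) memvN (tabP1J2 b_table).
- by rewrite (contraction_ii b_lie b_dec) // scale0r.
- by rewrite contraction_hh // (tabJ2J2 b_table).
- by rewrite contraction_hi // (tabJ2P2 b_table).
by rewrite (contraction_ii b_lie b_dec) // oppr0 scale0r.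
Qed.

End BracketTable.

(** * The metric *)

Lemma delta_sym (R : realType) n (i j : 'I_n) : delta i j = delta j i :> R.
Proof. by rewrite /delta eq_sym. Qed.

Section GeneratorMetric.
Variable R : realType.

Definition gen_metric (x y : gen) : R :=
  match x, y with
  | GJ1 A, GP1 B | GP1 A, GJ1 B => eta A B
  | GJ2 A B, GP2 C D | GP2 A B, GJ2 C D => kappa R A B C D
  | _, _ => 0
  end.

(** The relations satisfied by every linear functional evaluated on generators; a function obeying
    them is determined by its values on labels. *)
Definition tensor_additive (f : gen -> R) : Prop :=
  [/\ forall A B, f (GJ2 A B) = f (GJ2 B A),
      forall A B, f (GP2 A B) = f (GP2 B A),
      f (GJ2 ord0 ord0) = \sum_(a < 2) f (GJ2 (sp a) (sp a))
    & f (GP2 ord0 ord0) = \sum_(a < 2) f (GP2 (sp a) (sp a))].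

Lemma eq_tensor_additive (f f' : gen -> R) :
  tensor_additive f -> tensor_additive f' ->
  (forall l, f (gen_of_label l) = f' (gen_of_label l)) -> f =1 f'.
Proof.
move=> [fJ fP fJ0 fP0] [f'J f'P f'J0 f'P0] ff' [A|A|A B|A B].
- by case: (indexP A) => [|a]; [apply: (ff' LJ)|apply: (ff' (LG a))].
- by case: (indexP A) => [|a]; [apply: (ff' LH)|apply: (ff' (LP a))].
- case: (indexP A) (indexP B) => [|a] [|b].
  + by rewrite fJ0 f'J0; apply: eq_bigr => a _; apply: (ff' (LGG a a)).
  + exact: (ff' (LJv b)).
  + by rewrite fJ f'J; apply: (ff' (LJv a)).
  exact: (ff' (LGG a b)).
case: (indexP A) (indexP B) => [|a] [|b].
+ by rewrite fP0 f'P0; apply: eq_bigr => a _; apply: (ff' (LPP a a)).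
+ exact: (ff' (LHv b)).
+ by rewrite fP f'P; apply: (ff' (LHv a)).
exact: (ff' (LPP a b)).
Qed.

Lemma gen_metricC x y : gen_metric x y = gen_metric y x.
Proof.
case: x y => [?|?|? ?|? ?] [?|?|? ?|? ?];
  by [exact: erefl | exact: eta_sym | exact: kappaC].
Qed.

Lemma tensor_additive_gen_metric x : tensor_additive (gen_metric x).
Proof.
case: x => [A|A|A B|A B]; split=> [C D|C D||];
  by [exact: erefl | rewrite big1 | exact: kappa_symr | exact: kappa_trace].
Qed.

Lemma eta_spE a b : eta (sp a) (sp b) = delta a b :> R.
Proof. by rewrite /eta /delta (inj_eq lift_inj) sp_neq0; case: eqP. Qed.

Lemma eta_time_sp b : eta ord0 (sp b) = 0 :> R.
Proof. by rewrite /eta eq_sym sp_neq0. Qed.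

Lemma eta_sp_time b : eta (sp b) ord0 = 0 :> R.
Proof. by rewrite /eta sp_neq0. Qed.

Lemma eta_time_time : eta ord0 ord0 = -1 :> R.
Proof. by []. Qed.

Lemma metric_componentC l m : metric_component l m = metric_component m l :> R.
Proof. by case: l m => [|?||?|?|? ?|?|? ?] [|?||?|?|? ?|?|? ?]. Qed.

Lemma gen_metric_label l m :
  gen_metric (gen_of_label l) (gen_of_label m) = metric_component l m.
Proof.
(* Symmetry removes the cases with [l] in [h1] and [m] in [i1]. *)
wlog: l m / ~~ in_h1 l || in_h1 m => [H|].
  have [lm|] := boolP (~~ in_h1 l || in_h1 m); first exact: H.
  rewrite negb_or negbK => /andP[Jl Pm].
  by rewrite gen_metricC H ?Pm // metric_componentC.
case: l m => [|?||?|?|? ?|?|? ?] [|?||?|?|? ?|?|? ?] // _;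
  rewrite /= ?/kappa ?(eta_spE, eta_time_sp, eta_sp_time, eta_time_time);
  by [ring | rewrite delta_sym; ring].
Qed.

End GeneratorMetric.

(** * Values of the metric on generators and its invariance there *)

Section MetricOnGenerators.
Variables (R : realType) (L : vectType R) (s : background) (br : L -> L -> L).
Variable g : hs3_generators L.
Hypothesis hs3 : is_hs3 s br g.
Variable B : {symmetric L}.
Hypothesis B_comp : has_metric_components g B.

Lemma symC (x y : L) : B x y = B y x.
Proof. by rewrite hermC expr0 mul1r. Qed.

Lemma tensor_additive_form v : tensor_additive (fun x => B v (gen_vec g x)).
Proof.
split=> [C D|C D||] /=.
- by rewrite (hs3_J2_sym hs3).
- by rewrite (hs3_P2_sym hs3).
- by rewrite (J2_time_time hs3) linear_sumr.
by rewrite (P2_time_time hs3) linear_sumr.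
Qed.

(** Both sides respect symmetry and tracelessness in each argument, so agreement on labels extends
    to all generators, one argument at a time. *)
Lemma form_gen x y : B (gen_vec g x) (gen_vec g y) = gen_metric R x y.
Proof.
move: y; apply: eq_tensor_additive.
- exact: tensor_additive_form.
- exact: tensor_additive_gen_metric.
move=> m; rewrite symC gen_metricC; move: x.
apply: eq_tensor_additive => [||l].
- exact: tensor_additive_form.
- exact: tensor_additive_gen_metric.
by rewrite -!basis_vecE B_comp gen_metric_label.
Qed.

Lemma form_raise v (X : 'I_3 -> L) A :
  B v (raise X A) = \sum_(N < 3) eta A N * B v (X N).
Proof. by rewrite /raise linear_sumr; apply: eq_bigr => N _; rewrite linearZr. Qed.

Lemma form_eps_vec v (X : 'I_3 -> L) A C :
  B v (eps_vec X A C) = \sum_(M < 3) eps A C M * \sum_(N < 3) eta M N * B v (X N).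
Proof.
rewrite /eps_vec linear_sumr; apply: eq_bigr => M _.
by rewrite linearZr /= form_raise.
Qed.

Lemma form_eps_tens v (X : 'I_3 -> 'I_3 -> L) A C D :
  B v (eps_tens X A C D) =
  \sum_(M < 3) (eps_up M A C * B v (X D M) + eps_up M A D * B v (X C M)).
Proof.
rewrite /eps_tens linear_sumr; apply: eq_bigr => M _.
by rewrite /sym2 linearDr /= !linearZr.
Qed.

Lemma form_eta_eps_vec v (X : 'I_3 -> L) A C D E :
  B v (eta_eps_vec X A C D E) =
  \sum_(M < 3) sym_nested (fun A' C' D' B' => eta A' C' * eps D' B' M) A D E C
     * \sum_(N < 3) eta M N * B v (X N).
Proof.
rewrite /eta_eps_vec linear_sumr; apply: eq_bigr => M _.
by rewrite linearZr /= form_raise.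
Qed.

Lemma sum_eta_eta M A : \sum_(N < 3) eta M N * eta A N = (M == A)%:R :> R.
Proof.
rewrite (bigD1 M) //= big1 ?addr0 => [|N nNM]; last first.
  by rewrite /eta eq_sym (negPf nNM) mul0r.
rewrite /eta eqxx [A == M]eq_sym; case: (eqVneq M A) => [->|_].
  by case: eqP => _; rewrite ?mulrNN mulr1.
by rewrite mulr0.
Qed.

Let J1P1 A C : B (gJ1 g A) (gP1 g C) = eta A C.
Proof. exact: (form_gen (GJ1 A) (GP1 C)). Qed.
Let P1J1 A C : B (gP1 g A) (gJ1 g C) = eta A C.
Proof. exact: (form_gen (GP1 A) (GJ1 C)). Qed.
Let J2P2 A C D E : B (gJ2 g A C) (gP2 g D E) = kappa R A C D E.
Proof. exact: (form_gen (GJ2 A C) (GP2 D E)). Qed.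
Let P2J2 A C D E : B (gP2 g A C) (gJ2 g D E) = kappa R A C D E.
Proof. exact: (form_gen (GP2 A C) (GJ2 D E)). Qed.
Let J1P2 A C D : B (gJ1 g A) (gP2 g C D) = 0.
Proof. exact: (form_gen (GJ1 A) (GP2 C D)). Qed.
Let J2P1 A C D : B (gJ2 g C D) (gP1 g A) = 0.
Proof. exact: (form_gen (GJ2 C D) (GP1 A)). Qed.
Let P1J2 A C D : B (gP1 g A) (gJ2 g C D) = 0.
Proof. exact: (form_gen (GP1 A) (GJ2 C D)). Qed.
Let P2J1 A C D : B (gP2 g C D) (gJ1 g A) = 0.
Proof. exact: (form_gen (GP2 C D) (GJ1 A)). Qed.

Let eps_vec0 v (X : 'I_3 -> L) A C :
  (forall N, B v (X N) = 0) -> B v (eps_vec X A C) = 0.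
Proof.
move=> X0; rewrite form_eps_vec big1 // => M _.
by rewrite big1 ?mulr0 // => N _; rewrite X0 mulr0.
Qed.

Let eps_tens0 v (X : 'I_3 -> 'I_3 -> L) A C D :
  (forall M N, B v (X M N) = 0) -> B v (eps_tens X A C D) = 0.
Proof.
by move=> X0; rewrite form_eps_tens big1 // => M _; rewrite !X0 !mulr0 addr0.
Qed.

Let eta_eps_vec0 v (X : 'I_3 -> L) A C D E :
  (forall N, B v (X N) = 0) -> B v (eta_eps_vec X A C D E) = 0.
Proof.
move=> X0; rewrite form_eta_eps_vec big1 // => M _.
by rewrite big1 ?mulr0 // => N _; rewrite X0 mulr0.
Qed.

Let eps_vecE v (X : 'I_3 -> L) A C D : (forall N, B v (X N) = eta D N) ->
  B v (eps_vec X A C) = eps A C D.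
Proof.
move=> XE; rewrite form_eps_vec.
have S M : \sum_(N < 3) eta M N * B v (X N) = (M == D)%:R.
  by rewrite -sum_eta_eta; apply: eq_bigr => N _; rewrite XE.
rewrite (bigD1 D) //= S eqxx mulr1 big1 ?addr0 // => M nMD.
by rewrite S (negPf nMD) mulr0.
Qed.

Let eps_tensE v (X : 'I_3 -> 'I_3 -> L) A C D E F :
  (forall M N, B v (X M N) = kappa R M N E F) ->
  B v (eps_tens X A C D) = tensor_action R A C D E F.
Proof.
by move=> XE; rewrite form_eps_tens; apply: eq_bigr => M _; rewrite !XE.
Qed.

Let eta_eps_vecE v (X : 'I_3 -> L) A C D E F :
  (forall N, B v (X N) = eta A N) ->
  - B v (eta_eps_vec X C D E F) = tensor_action R A C D E F.
Proof.
move=> XE; rewrite tensor_action_bracket form_eta_eps_vec; congr (- _).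
apply: eq_bigr => M _; congr (_ * _).
by apply: eq_bigr => N _; rewrite XE.
Qed.

Let BNl (x y : L) : B (- x) y = - B x y. Proof. by rewrite linearNl. Qed.
Let BNr (x y : L) : B x (- y) = - B x y. Proof. by rewrite linearNr. Qed.

(** The eight cases are governed by the number of two-index generators. If it is odd, both sides
    vanish; if it is zero, the claim is cyclicity of [eps]; if it is two, it follows from the
    identities for [tensor_action]. *)
Lemma form_invariant_gen (c : R) (b : L -> L -> L) : is_lie_bracket b ->
  bracket_table g c b -> forall x y u, is_J x -> is_J y -> ~~ is_J u ->
  B (b (gen_vec g x) (gen_vec g y)) (gen_vec g u)
    = B (gen_vec g x) (b (gen_vec g y) (gen_vec g u)).
Proof.
move=> b_lie t.
case=> [A|//|A A'|//] [C|//|C C'|//] [//|D|//|D D'] /= _ _ _.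
- rewrite (tabJ1J1 t) (tabJ1P1 t) symC.
  rewrite (@eps_vecE _ _ _ _ D) // (@eps_vecE _ _ _ _ A) //.
  exact: eps_cyclic.
- by rewrite (tabJ1J1 t) (tabJ1P2 t) symC eps_vec0 ?eps_tens0.
- rewrite (tabJ1J2 t) symC eps_tens0 // (lieC b_lie) (tabP1J2 t) BNr eps_tens0 //.
  by rewrite oppr0.
- rewrite (tabJ1J2 t) (tabJ2P2 t) BNr (@eta_eps_vecE _ _ A) // symC.
  by apply: eps_tensE => M N; rewrite P2J2 kappaC.
- rewrite (lieC b_lie) (tabJ1J2 t) (tabJ1P1 t) BNl symC eps_tens0 // eps_vec0 //.
  by rewrite oppr0.
- rewrite (lieC b_lie) (tabJ1J2 t) (tabJ1P2 t) BNl symC.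
  rewrite (@eps_tensE _ _ _ _ _ D D') => [|M N]; last by rewrite P2J2 kappaC.
  rewrite (@eps_tensE _ _ _ _ _ A A') => [|M N]; last by rewrite J2P2 kappaC.
  by rewrite [RHS]tensor_action_antisym.
- rewrite (tabJ2J2 t) (lieC b_lie (gJ2 g _ _)) (tabP1J2 t) BNl BNr symC.
  rewrite (@eta_eps_vecE _ _ D) // (@eps_tensE _ _ _ _ _ A A').
    exact: tensor_action_antisym.
  by move=> M N; rewrite J2P2 kappaC.
by rewrite (tabJ2J2 t) (tabJ2P2 t) BNl BNr symC !eta_eps_vec0.
Qed.

End MetricOnGenerators.

(** One label for each of the 16 independent vectors: a symmetric spatial tensor keeps only its
    components with ordered indices. *)
Definition basis_labels : seq label :=
  [:: LJ; LG ord0; LG ord_max; LJv ord0; LJv ord_max;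
      LGG ord0 ord0; LGG ord0 ord_max; LGG ord_max ord_max;
      LH; LP ord0; LP ord_max; LHv ord0; LHv ord_max;
      LPP ord0 ord0; LPP ord0 ord_max; LPP ord_max ord_max].

Variant spatial_spec : 'I_2 -> Type :=
  | Spatial1 : spatial_spec ord0
  | Spatial2 : spatial_spec ord_max.

Lemma spatialP a : spatial_spec a.
Proof.
case: a => [[|[|//]] lt_a]; rewrite (bool_irrelevance lt_a isT).
  rewrite (_ : Ordinal _ = ord0); [exact: Spatial1 | exact: val_inj].
rewrite (_ : Ordinal _ = ord_max); [exact: Spatial2 | exact: val_inj].
Qed.

(** * Existence and nondegeneracy of the metric *)

Section Metric.
Variables (R : realType) (L : vectType R) (s : background) (br : L -> L -> L).
Variable g : hs3_generators L.
Hypothesis hs3 : is_hs3 s br g.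

(** Labels naming the same vector also have the same metric components, so the prescribed components
    are consistent. *)
Lemma basis_label_exists l : exists2 m, m \in basis_labels &
  basis_vec g l = basis_vec g m
  /\ forall k, metric_component l k = metric_component m k :> R.
Proof.
have [lb|] := boolP (l \in basis_labels); first by exists l.
case: l => [|a||a|a|a b|a|a b] //; try by case: (spatialP a).
- case: (spatialP a) (spatialP b) => [] [] // _.
  exists (LGG ord0 ord_max) => //; split; first exact: (hs3_J2_sym hs3).
  by case=> //= c d; rewrite [delta ord_max ord0]delta_sym; ring.
case: (spatialP a) (spatialP b) => [] [] // _.
exists (LPP ord0 ord_max) => //; split; first exact: (hs3_P2_sym hs3).
by case=> //= c d; rewrite (delta_sym R ord_max ord0) (delta_sym R ord_max c)
  (delta_sym R ord0 c) (delta_sym R ord_max d) (delta_sym R ord0 d); ring.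
Qed.

Let X : 16.-tuple L := [tuple of map (basis_vec g) basis_labels].

Let X_nth i : (i < 16)%N -> X`_i = basis_vec g (nth LJ basis_labels i).
Proof. by move=> ?; rewrite (nth_map LJ). Qed.

Lemma span_basis_vec : <<X>>%VS = fullv.
Proof.
apply: (span_generators hs3) => l.
have [m mb [-> _]] := basis_label_exists l.
by rewrite memv_span // map_f.
Qed.

Lemma free_basis_vec : free X.
Proof.
apply: (@basis_free _ _ fullv); rewrite basisEdim size_tuple (hs3_dim hs3).
by rewrite span_basis_vec subvv.
Qed.

Lemma exists_metric : exists B : {symmetric L}, has_metric_components g B.
Proof.
have [|B BX] := @exists_symmetric_form R L 16 X
  (fun i j => metric_component (nth LJ basis_labels i) (nth LJ basis_labels j))
  free_basis_vec.
  by move=> i j; apply: metric_componentC.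
exists B => l m.
have [l' lb [-> ->]] := basis_label_exists l.
have [m' mb [-> ml]] := basis_label_exists m.
rewrite metric_componentC ml metric_componentC.
have li : (index l' basis_labels < 16)%N by rewrite index_mem.
have mi : (index m' basis_labels < 16)%N by rewrite index_mem.
have := BX (Ordinal li) (Ordinal mi).
by rewrite !X_nth // [nth _ _ (Ordinal li)]nth_index //
  [nth _ _ (Ordinal mi)]nth_index.
Qed.

Lemma metric_nondegenerate (B : {symmetric L}) :
  has_metric_components g B -> nondegenerate B.
Proof.
move=> comp; rewrite /nondegenerate -subv0; apply/subvP => x /mem_orthovP xrad.
(* Indexing coordinates by natural numbers lets the sum below unfold into sixteen explicit terms. *)
pose d k := coord X (inord k) x.
have E m : \sum_(0 <= k < 16) d k * metric_component (nth LJ basis_labels k) m = 0.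
  apply: etrans (xrad (basis_vec g m) (memvf _)); rewrite big_mkord.
  have xE : x = \sum_i coord X i x *: X`_i.
    by apply: (coord_span (X := X)); rewrite span_basis_vec memvf.
  rewrite [in RHS]xE linear_sumlz; apply: eq_bigr => i _.
  by rewrite linearZl_LR /= X_nth // comp /d inord_val.
rewrite memv0 (coord_span (X := X) (v := x)) ?span_basis_vec ?memvf //.
rewrite big1 // => i _; rewrite (_ : coord X i x = 0) ?scale0r //.
rewrite -[i]inord_val -/(d i).
(* Pairing [x] with each basis vector gives sixteen linear equations. Up to sign they read off
   single coordinates, except for the diagonal spatial tensors, where the block with rows (4/3,
   -2/3) and (-2/3, 4/3) is invertible. *)
have e0 := E LJ; have e1 := E (LG ord0); have e2 := E (LG ord_max).
have e3 := E (LJv ord0); have e4 := E (LJv ord_max).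
have e5 := E (LGG ord0 ord0); have e6 := E (LGG ord0 ord_max).
have e7 := E (LGG ord_max ord_max).
have f0 := E LH; have f1 := E (LP ord0); have f2 := E (LP ord_max).
have f3 := E (LHv ord0); have f4 := E (LHv ord_max).
have f5 := E (LPP ord0 ord0); have f6 := E (LPP ord0 ord_max).
have f7 := E (LPP ord_max ord_max).
move: e0 e1 e2 e3 e4 e5 e6 e7 f0 f1 f2 f3 f4 f5 f6 f7.
rewrite unlock /= /delta !eqE /=.
rewrite !(mulr0n, mulr1n, mulr0, mul0r, oppr0, addr0, add0r, mulr1).
move: d {E} => d *.
case: i => k /= lt_k.
do 16?[case: k lt_k => [_|k lt_k]; first by lra].
by [].
Qed.

End Metric.

(** * The contraction procedures *)

Section Procedures.
Variables (R : realType) (L : vectType R) (s : background) (br : L -> L -> L).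
Variable g : hs3_generators L.
Hypothesis hs3 : is_hs3 s br g.
Variable B : {symmetric L}.
Hypothesis B_comp : has_metric_components g B.

Definition isotropic_labels (p : pred label) : Prop :=
  forall l m, p l -> p m -> metric_component l m = 0 :> R.

Lemma gen_vec_mem_span (p : pred gen) (q : pred label) (t : seq label) :
  tensor_compatible p -> (forall l, p (gen_of_label l) = q l) ->
  enumerates t q -> forall x, p x -> gen_vec g x \in span_labels g t.
Proof.
move=> p_comp pq [_ qt]; apply: (gen_vec_mem hs3) => // l.
by rewrite pq => /qt; apply: basis_vec_mem_span.
Qed.

Lemma isotropic_span (p : pred label) (t : seq label) :
  enumerates t p -> isotropic_labels p ->
  {in span_labels g t &, forall x y, B x y = 0}.
Proof.
move=> [/allP tp _] p_iso; apply/(@orthovP _ _ _ _ B); rewrite -orthogonalE.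
apply/orthogonalP => _ _ /mapP[l lt ->] /mapP[m mt ->].
by rewrite B_comp p_iso ?tp.
Qed.

(* A vector of both isotropic halves is orthogonal to everything, so the sum is
   direct by nondegeneracy. *)
Lemma decomposition_isotropic (p : pred label) (t u : seq label)
    (b : L -> L -> L) : is_lie_bracket b ->
  enumerates t p -> enumerates u (predC p) ->
  isotropic_labels p -> isotropic_labels (predC p) ->
  (forall l m, p l -> p m ->
     b (basis_vec g l) (basis_vec g m) \in span_labels g t) ->
  is_decomposition b (span_labels g t) (span_labels g u).
Proof.
move=> b_lie t_p u_p p_iso Cp_iso closed.
have full : (span_labels g t + span_labels g u)%VS = fullv.
  apply: (span_generators hs3) => l; have [pl|pl] := boolP (p l).
    by apply/(subvP (addvSl _ _))/basis_vec_mem_span/(proj2 t_p).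
  by apply/(subvP (addvSr _ _))/basis_vec_mem_span/(proj2 u_p).
split=> //; last first.
  apply: lie_span_mem => // _ _ /mapP[l lt ->] /mapP[m mt ->].
  by case: t_p => /allP tp _; apply: closed; apply: tp.
apply/directv_addP/eqP; rewrite -subv0; apply/subvP=> x; rewrite memv_cap.
case/andP=> xt xu; have /eqP <- := metric_nondegenerate hs3 B_comp.
apply/mem_orthovP => y; rewrite -full => /memv_addP[v vt [w wu ->]].
rewrite linearDr /= (isotropic_span t_p) // add0r.
exact: (isotropic_span u_p).
Qed.

Lemma form_invariant_span (b : L -> L -> L) (t u v : seq label) :
  is_lie_bracket b ->
  (forall l m n, l \in t -> m \in u -> n \in v ->
     B (b (basis_vec g l) (basis_vec g m)) (basis_vec g n)
       = B (basis_vec g l) (b (basis_vec g m) (basis_vec g n))) ->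
  forall x y z, x \in span_labels g t -> y \in span_labels g u ->
    z \in span_labels g v -> B (b x y) z = B x (b y z).
Proof.
move=> b_lie H x y z xt yu zv; move: x xt; apply: span_ind.
- by rewrite (lie0l b_lie) !linear0l.
- by move=> a x x' E E'; rewrite (lie_linearl b_lie) !linearPl /= E E'.
move=> _ /mapP[l lt ->]; move: y yu; apply: span_ind.
- by rewrite (lie0l b_lie) (lie0r b_lie) linear0l linear0r.
- move=> a y y' E E'; rewrite (lie_linearr b_lie) (lie_linearl b_lie).
  by rewrite linearPl linearPr /= E E'.
move=> _ /mapP[m mu ->]; move: z zv; apply: span_ind.
- by rewrite (lie0r b_lie) !linear0r.
- by move=> a z z' E E'; rewrite (lie_linearr b_lie) !linearPr /= E E'.
by move=> _ /mapP[n nv ->]; apply: H.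
Qed.

(** In all three decompositions, each nonzero metric component pairs a label of one half with a
    label of the other. *)
Lemma isotropic_h1 : isotropic_labels in_h1.
Proof. by case=> [|?||?|?|? ?|?|? ?] [|?||?|?|? ?|?|? ?]. Qed.

Lemma isotropic_i1 : isotropic_labels (predC in_h1).
Proof. by case=> [|?||?|?|? ?|?|? ?] [|?||?|?|? ?|?|? ?]. Qed.

Lemma isotropic_h5 : isotropic_labels in_h5.
Proof. by case=> [|?||?|?|? ?|?|? ?] [|?||?|?|? ?|?|? ?]. Qed.

Lemma isotropic_i5 : isotropic_labels (predC in_h5).
Proof. by case=> [|?||?|?|? ?|?|? ?] [|?||?|?|? ?|?|? ?]. Qed.

Lemma isotropic_h6 : isotropic_labels in_h6.
Proof. by case=> [|?||?|?|? ?|?|? ?] [|?||?|?|? ?|?|? ?]. Qed.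

Lemma isotropic_i6 : isotropic_labels (predC in_h6).
Proof. by case=> [|?||?|?|? ?|?|? ?] [|?||?|?|? ?|?|? ?]. Qed.

Let br_lie : is_lie_bracket br := hs3_lie hs3.
Let br_table : bracket_table g (bg_sign s) br := hs3_table hs3.
Let br1 := procedure g h1 i1 br.

Let J_h1 : forall x, is_J x -> gen_vec g x \in span_labels g h1.
Proof.
exact: (gen_vec_mem_span tensor_compatible_is_J is_J_label enumerates_h1).
Qed.

Let P_i1 : forall x, ~~ is_J x -> gen_vec g x \in span_labels g i1.
Proof.
have P_comp := tensor_compatibleC tensor_compatible_is_J.
apply: (gen_vec_mem_span P_comp _ enumerates_i1).
by move=> l; rewrite /= is_J_label.
Qed.

Lemma procedure1_applies : procedure_applies g h1 i1 br.
Proof.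
apply: (decomposition_isotropic br_lie enumerates_h1 enumerates_i1).
- exact: isotropic_h1.
- exact: isotropic_i1.
move=> l m Jl Jm; rewrite !basis_vecE.
by apply: (J_closed br_lie br_table) => //; rewrite is_J_label.
Qed.

Lemma procedure1_lie : is_lie_bracket br1.
Proof. exact: contraction_lie br_lie procedure1_applies. Qed.

Lemma procedure1_table : bracket_table g 0 br1.
Proof.
exact: (contraction_table br_lie br_table J_h1 P_i1 procedure1_applies).
Qed.

Lemma procedure1_ad_invariant : ad_invariant br1 B.
Proof.
apply: (contraction_ad_invariant br_lie procedure1_applies).
- exact: isotropic_span enumerates_h1 isotropic_h1.
- exact: isotropic_span enumerates_i1 isotropic_i1.
apply: form_invariant_span => // l m n lh mh ni; rewrite !basis_vecE.
have [/allP h1J _] := enumerates_h1; have [/allP i1P _] := enumerates_i1.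
apply: (form_invariant_gen hs3 B_comp br_lie br_table); rewrite is_J_label.
- exact: h1J.
- exact: h1J.
exact: i1P.
Qed.

(** Treats both second procedures at once: the degree-0 part of the grading is closed under the
    bracket left by procedure 1, and the half-spaces are isotropic. *)
Lemma procedure_parity (e : bool) (p : pred label) (t u : seq label) :
  (forall l, parity e (gen_of_label l) = p l) ->
  enumerates t p -> enumerates u (predC p) ->
  isotropic_labels p -> isotropic_labels (predC p) ->
  [/\ procedure_applies g t u br1, is_lie_bracket (procedure g t u br1)
    & ad_invariant (procedure g t u br1) B].
Proof.
move=> ep t_p u_p p_iso Cp_iso.
have dec : procedure_applies g t u br1.
  apply: (decomposition_isotropic procedure1_lie t_p u_p p_iso Cp_iso) => l m pl pm.
  rewrite !basis_vecE.
  apply: (parity_closed procedure1_lie procedure1_table (e := e)); rewrite ?ep //.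
  exact: (gen_vec_mem_span (tensor_compatible_parity e) ep t_p).
split=> //; first exact: contraction_lie procedure1_lie dec.
apply: (contraction_ad_invariant procedure1_lie dec) => [||x y z _ _ _].
- exact: isotropic_span t_p p_iso.
- exact: isotropic_span u_p Cp_iso.
(* The bracket from procedure 1 is already invariant on all of [L], in particular on the triples
   needed here. *)
exact: procedure1_ad_invariant.
Qed.

End Procedures.

Theorem mainTheorem2 (R : realType) (L : vectType R) (s : background)
    (br : L -> L -> L) (g : hs3_generators L) (Hhs3 : is_hs3 s br g) :
  [/\ procedure_applies g h1 i1 br,
      procedure_applies g h5 i5 (procedure g h1 i1 br)
        /\ is_lie_bracket (hs3car1 br g),
      procedure_applies g h6 i6 (procedure g h1 i1 br)
        /\ is_lie_bracket (hs3car2 br g)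
    & exists B : {symmetric L},
        [/\ has_metric_components g B,
            invariant_metric (hs3car1 br g) B
          & invariant_metric (hs3car2 br g) B]].
Proof.
have [B comp] := exists_metric Hhs3.
have nondeg := metric_nondegenerate Hhs3 comp.
(* The grading with [false] gives procedure 5 and the one with [true] procedure 6; the same [B]
   serves both. *)
have [dec5 lie5 inv5] := procedure_parity Hhs3 comp (parity_label false)
  enumerates_h5 enumerates_i5 (@isotropic_h5 R) (@isotropic_i5 R).
have [dec6 lie6 inv6] := procedure_parity Hhs3 comp (parity_label true)
  enumerates_h6 enumerates_i6 (@isotropic_h6 R) (@isotropic_i6 R).
split=> //; first exact: (procedure1_applies Hhs3 comp).
by exists B.
Qed.
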